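(* Let $n,N\ge 2$ and $\varepsilon\ge 1$ be integers with $\varepsilon/n\le 1/2$, let $\alpha<h(\varepsilon/n)$, and suppose $$N\le 2+2^{-\varepsilon}\left(\frac{1-\varepsilon/n}{\varepsilon/n}\right)^{\lceil\frac{\varepsilon+1}{2}\rceil}\left(\frac{1}{\sqrt{8\varepsilon(1-\varepsilon/n)}}-2^{-n\alpha}\right).$$ Let $v_1,\dots,v_N$ be independent uniform templates in $\mathbb{Z}_2^n$, let $W_0$ be the event that $d_{\mathcal H}(v_i,v_j)\le\varepsilon$ for some $i\ne j$, and for each $k$ let $v_k'$ be uniform in $\mathbb{Z}_2^n$ independent of everything else and $p_k=\mathbb{P}\left(v_k'\in\bigcup_{j\ne k}B_\varepsilon(v_j)\,\middle|\,\overline{W_0}\right)$. Let $p_w=1-\prod_{k=1}^N(1-p_k)$ and $m_{in}=\left\lceil\frac{-\ln 2}{\ln(1-p_w)}\right\rceil$ be the median number of rounds until at least one of the users successfully impersonates another one. Then $$m_{in}=\Omega\left(2^{n(1-h(\varepsilon/n))-3\log_2(N)}\right)\quad\text{and}\quad m_{in}=O\left(2^{n(1-h(\varepsilon/n)+\alpha)-2\log_2(N)}\right).$$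
   Context: Templates lie in $\mathbb{Z}_2^n$ with Hamming distance $d_{\mathcal H}$; $B_\varepsilon(t)=\{y: d_{\mathcal H}(t,y)\le\varepsilon\}$. Insider scenario: all $N$ enrolled users are attackers; in each round every user $k$ draws a fresh uniform template $v_k'$ and tries to match another user's enrolled template (within distance $\varepsilon$); rounds are independent. $h(x)=-x\log_2x-(1-x)\log_2(1-x)$ is the binary entropy function. *)

(* Defs.v *)
From HB Require Import structures.
From mathcomp Require Import all_boot all_order all_algebra.
From mathcomp Require Import all_classical all_reals all_analysis.
Set Implicit Arguments. Unset Strict Implicit. Unset Printing Implicit Defensive.
Import Order.TTheory GRing.Theory Num.Theory.
Local Open Scope ring_scope.

Definition template (n : nat) := {ffun 'I_n -> bool}.

Definition ham (n : nat) (x y : template n) : nat := #|[set i | x i != y i]|.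

Definition in_ball (n eps : nat) (t y : template n) : bool := (ham t y <= eps)%N.

Definition Pr (R : realType) (T : finType) (A : {set T}) : R := #|A|%:R / #|T|%:R.
Definition condPr (R : realType) (T : finType) (A B : {set T}) : R :=
  Pr R (A :&: B) / Pr R B.

(* sample space: enrolled templates v_1..v_N and fresh templates v'_1..v'_N,
   all independent and uniform (uniform measure on the product). *)
Definition Omega (n N : nat) := ({ffun 'I_N -> template n} * {ffun 'I_N -> template n})%type.

Definition W0 (n N eps : nat) : {set Omega n N} :=
  [set w : Omega n N | [exists i : 'I_N, exists j : 'I_N, (i != j) && @in_ball n eps (w.1 i) (w.1 j)]].

Definition hit (n N eps : nat) (k : 'I_N) : {set Omega n N} :=
  [set w : Omega n N | [exists j : 'I_N, (j != k) && @in_ball n eps (w.1 j) (w.2 k)]].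

Definition p_k (R : realType) (n N eps : nat) (k : 'I_N) : R :=
  condPr R (@hit n N eps k) (~: @W0 n N eps).

Definition p_w (R : realType) (n N eps : nat) : R :=
  1 - \prod_(k < N) (1 - @p_k R n N eps k).

Definition m_in (R : realType) (n N eps : nat) : R :=
  (Num.ceil (- ln (2 : R) / ln (1 - p_w R n N eps)))%:~R.

Definition log2 (R : realType) (x : R) : R := ln x / ln 2.

Definition hbin (R : realType) (x : R) : R :=
  - x * log2 x - (1 - x) * log2 (1 - x).

(* Main.v *)
Require Import Defs.
From HB Require Import structures.
From mathcomp Require Import all_boot all_order all_algebra.
From mathcomp Require Import all_classical all_reals all_analysis.
From mathcomp Require Import zify ring lra.
Import Order.TTheory GRing.Theory Num.Theory.
Local Open Scope ring_scope.

(** Write [a = eps], [n = a + b], [y = a / b <= 1] and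
    [E = 2 ^ (n h(a / n)) = (1 + y) ^ n / y ^ a], and let V be the volume of a ball.
    Then [E / sqrt (8 a (1 - a / n)) <= 'C(n, a) <= V <= E].  Two balls whose centres
    are more than [a] apart meet in at most [2 * 2 ^ a * y ^ (a./2 + 1) * E] points:
    the intersection only grows when the centres are moved to distance exactly
    [a + 1], where counting with weights [y] outside the differing coordinates gives
    the bound.  By Bonferroni and the assumption on N, the union of the N - 1 balls
    around a code has at least [(N - 1) 2 ^ (n (h - alpha))] and at most
    [(N - 1) V] points, which brackets every p_k, as p_k is the average of this
    volume, divided by [2 ^ n], over all codes.

    The assumption on N also gives [(N - 1) V < 2 ^ n], so that codes exist
    (otherwise the conditional probabilities would be 0 / 0 = 0 and m_in = 0), and
    [(N - 1) ^ 2 V = O(2 ^ n)], which absorbs the rounding of the ceiling in the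
    upper bound. *)

(** * Hamming balls and their intersections *)

Definition ball_set n eps (t : template n) : {set template n} :=
  [set y | in_ball eps t y].

Definition flip n (i : 'I_n) (p : template n) : template n :=
  [ffun j => p j (+) (j == i)].

Lemma flipK n (i : 'I_n) : involutive (flip n i).
Proof. by move=> p; apply/ffunP => j; rewrite !ffunE -addbA addbb addbF. Qed.

Lemma hamE n (x y : template n) : ham x y = (\sum_i (x i != y i))%N.
Proof. by rewrite /ham -sum1dep_card big_mkcond /=; apply: eq_bigr => i _; case: ifP. Qed.

Lemma ham_sym n (x y : template n) : ham x y = ham y x.
Proof. by rewrite !hamE; apply: eq_bigr => i _; rewrite eq_sym. Qed.

Lemma ham_flipC n (i : 'I_n) (x y : template n) :
  ham (flip n i x) y = ham x (flip n i y).
Proof.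
rewrite !hamE; apply: eq_bigr => j _; rewrite !ffunE.
by case: (x j) (y j) (j == i) => [] [] [].
Qed.

Lemma ham_flip_neq n (i : 'I_n) (x y : template n) :
  x i != y i -> ham x y = (ham (flip n i x) y).+1.
Proof.
move=> xy; rewrite !hamE (bigD1 i) //= [in RHS](bigD1 i) //= !ffunE eqxx xy.
have -> : (x i (+) true != y i) = false by move: xy; case: (x i) (y i) => [] [].
rewrite add1n add0n; congr _.+1; apply: eq_bigr => j /negbTE ji.
by rewrite ffunE ji addbF.
Qed.

Lemma ham_flip_eq n (i : 'I_n) (x y : template n) :
  x i = y i -> ham (flip n i x) y = (ham x y).+1.
Proof.
move=> xy; rewrite (ham_flip_neq _ i) ?flipK // ffunE eqxx xy.
by case: (y i).
Qed.

(* Pairing each [p] with [flip i p] turns the claim into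
   ([a <= e] - [a' <= e]) ([b' <= e] - [b <= e]) >= 0, where a, a' (resp. b', b)
   are the distances of p and flip i p to t (resp. to u' = flip i u). *)
Lemma card_ballI_flip n eps (i : 'I_n) (t u : template n) : t i != u i ->
  (#|ball_set n eps t :&: ball_set n eps u|
   <= #|ball_set n eps t :&: ball_set n eps (flip n i u)|)%N.
Proof.
move=> tu.
have E v : #|ball_set n eps t :&: ball_set n eps v| =
   (\sum_(p : template n) ((ham t p <= eps) && (ham v p <= eps)))%N.
  rewrite -sum1_card big_mkcond /=; apply: eq_bigr => p _.
  by rewrite !inE /in_ball; case: (_ && _).
have E2 v : (2 * #|ball_set n eps t :&: ball_set n eps v| = \sum_(p : template n)
   (((ham t p <= eps) && (ham v p <= eps)) +
    ((ham t (flip n i p) <= eps) && (ham v (flip n i p) <= eps))))%N.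
  rewrite big_split /= mul2n -addnn E; congr addn.
  by rewrite (reindex_inj (inv_inj (flipK n i))).
rewrite -(leq_pmul2l (m:=2)) // !E2; apply: leq_sum => p _.
have -> : ham (flip n i u) (flip n i p) = ham u p by rewrite ham_flipC flipK.
rewrite -(ham_flipC n i u).
have [tp|tp] := eqVneq (t i) (p i).
  have up : u i != p i by rewrite -tp eq_sym.
  rewrite -(ham_flipC n i t) (ham_flip_eq n i t) // (ham_flip_neq n i u) //.
  by lia.
have up : u i = p i by move: tp tu; case: (t i) (p i) (u i) => [] [] [].
rewrite -(ham_flipC n i t) (ham_flip_neq n i t) // (ham_flip_eq n i u) //.
by lia.
Qed.

Lemma ham_gt_flip n (t u : template n) : (0 < ham t u)%N ->
  exists2 i, t i != u i & ham t u = (ham t (flip n i u)).+1.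
Proof.
rewrite /ham card_gt0 => /set0Pn[i]; rewrite inE => tu; exists i => //.
by rewrite -!/(ham _ _) ham_sym (ham_flip_neq n i) 1?eq_sym // ham_sym.
Qed.

(** Flipping a coordinate where the centres differ lowers their distance by one, and by
    [card_ballI_flip] the intersection does not shrink; the induction runs on the excess
    distance. *)
Lemma card_ballI_far n eps d (t u : template n) : (d <= ham t u)%N ->
  exists2 u' : template n, ham t u' = d &
  (#|ball_set n eps t :&: ball_set n eps u|
   <= #|ball_set n eps t :&: ball_set n eps u'|)%N.
Proof.
move En : (ham t u - d)%N => k; elim: k u En => [|k IH] u Eu du.
  by exists u => //; lia.
have [|i tu E] := @ham_gt_flip _ t u; first by lia.
have [||u' hu' le] := IH (flip n i u); [by lia|by lia|].
by exists u' => //; apply: leq_trans le; exact: card_ballI_flip.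
Qed.

(** * Counting with product weights *)

Section weights.
Context {R : realType}.

Lemma sum_prod_template n (F : 'I_n -> bool -> R) :
  \sum_(p : template n) \prod_i F i (p i) = \prod_i (F i true + F i false).
Proof.
by rewrite -bigA_distr_bigA; apply: eq_bigr => i _; rewrite big_bool.
Qed.

(** Chernoff-type bound: the weights [y ^+ ham t p] have total mass [(1 + y) ^+ n], and each point
    of the ball carries at least [y ^+ eps] because [y <= 1]. *)
Lemma card_ball_weight n eps (t : template n) (y : R) : 0 < y <= 1 ->
  #|ball_set n eps t|%:R * y ^+ eps <= (1 + y) ^+ n.
Proof.
move=> /andP[y0 y1].
have -> : (1 + y) ^+ n = \sum_(p : template n) y ^+ (ham t p).
  under eq_bigr => p _ do rewrite hamE expr_sum.
  rewrite (sum_prod_template n (fun i b => y ^+ (t i != b))).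
  rewrite (eq_bigr (fun _ => 1 + y)) ?prodr_const ?card_ord // => i _.
  by case: (t i); rewrite /= expr0 expr1 // addrC.
rewrite -sum1_card natr_sum mulr_suml [leRHS](bigID (mem (ball_set n eps t))) /=.
rewrite -[leLHS]addr0; apply: lerD; last first.
  by apply: sumr_ge0 => p _; rewrite exprn_ge0 // ltW.
apply: ler_sum => p; rewrite inE /in_ball => tp; rewrite mul1r.
by apply: ler_wiXn2l => //; rewrite ltW.
Qed.

(** Only coordinates where [t] and [u] agree are weighted; the other [eps.+1] are free and
    contribute a factor 2 each. *)
Lemma card_ballI_weight n eps (t u : template n) (y : R) : 0 < y <= 1 ->
  (ham t u = eps.+1)%N ->
  #|ball_set n eps t :&: ball_set n eps u|%:R * y ^+ eps
    <= 2 ^+ eps.+1 * y ^+ (eps./2).+1 * (1 + y) ^+ n.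
Proof.
move=> /andP[y0 y1] tu.
pose out (p : template n) := (\sum_i ((t i == u i) && (t i != p i)))%N.
have Hsum : \sum_(p : template n) y ^+ (out p) <= 2 ^+ eps.+1 * (1 + y) ^+ n.
  under eq_bigr => p _ do rewrite /out expr_sum.
  rewrite (sum_prod_template n (fun i b => y ^+ ((t i == u i) && (t i != b)))).
  rewrite (eq_bigr (fun i => if t i == u i then 1 + y else 2)); last first.
    move=> i _; case: (t i == u i) => /=; rewrite ?expr0 //.
    by case: (t i); rewrite /= expr0 expr1 // addrC.
  rewrite -tu hamE expr_sum -[X in (1 + y) ^+ X]card_ord -prodr_const -big_split /=.
  apply: ler_prod => i _; case: (t i == u i) => /=.
    by rewrite expr0 mul1r; lra.
  by rewrite expr1; lra.
rewrite mulrAC.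
apply: (@le_trans _ _ ((\sum_(p : template n) y ^+ (out p)) * y ^+ (eps./2).+1)); last first.
  by rewrite ler_wpM2r // exprn_ge0 // ltW.
rewrite -sum1_card natr_sum !mulr_suml.
rewrite [leRHS](bigID (mem (ball_set n eps t :&: ball_set n eps u))) /=.
rewrite -[leLHS]addr0; apply: lerD; last first.
  by apply: sumr_ge0 => p _; rewrite mulr_ge0 // exprn_ge0 // ltW.
apply: ler_sum => p; rewrite !inE /in_ball => /andP[tp up]; rewrite mul1r -exprD.
apply: ler_wiXn2l => //; first by rewrite ltW.
(* Where [t] and [u] differ, [p] disagrees with exactly one of them. Hence
   [2 * out p + eps + 1 <= 2 * eps], which is what the exponent [(eps./2).+1] needs. *)
have : (ham t p + ham u p = 2 * out p + ham t u)%N.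
  rewrite !hamE -big_split /= /out big_distrr -big_split /=; apply: eq_bigr => i _.
  by case: (t i) (u i) (p i) => [] [] [].
by lia.
Qed.

End weights.

(** * Sizes of unions *)

(** Doubled so that the number of pairs needs no division. A new set loses at most its overlap with
    the earlier union, which is at most [size s * D]. *)
Lemma bonferroni_le (R : realDomainType) (I : eqType) (T : finType)
    (B : I -> {set T}) (s : seq I) (V D : R) : uniq s ->
  (forall j, j \in s -> V <= #|B j|%:R) ->
  (forall i j, i \in s -> j \in s -> i != j -> #|B i :&: B j|%:R <= D) ->
  2 * (size s)%:R * V
    <= 2 * #|\bigcup_(j <- s) B j|%:R + (size s)%:R * ((size s)%:R - 1) * D.
Proof.
elim: s => [|a s IH] /=; first by rewrite big_nil cards0 !(mulr0, mul0r, addr0).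
move=> /andP[aS us] hV hD.
have {}IH := IH us (fun j js => hV j (mem_behead (s := a :: s) js))
  (fun i j si sj => hD i j (mem_behead (s := a :: s) si) (mem_behead (s := a :: s) sj)).
rewrite big_cons.
have Ha : #|B a :&: \bigcup_(j <- s) B j|%:R <= (size s)%:R * D.
  have : {in s, forall j, #|B a :&: B j|%:R <= D}.
    move=> j js; apply: hD; rewrite ?inE ?eqxx ?js ?orbT //.
    by apply: contraNneq aS => ->.
  elim: (s) => [|b t IHt] hb; first by rewrite big_nil finset.setI0 cards0 mul0r.
  rewrite big_cons finset.setIUr /= -natr1 mulrDl mul1r addrC.
  apply: (@le_trans _ _ (#|B a :&: B b| + #|B a :&: \bigcup_(j <- t) B j|)%:R).
    by rewrite ler_nat leq_card_setU.
  rewrite natrD lerD //; first by apply: hb; rewrite mem_head.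
  by apply: IHt => j jt; apply: hb; rewrite inE jt orbT.
have /(congr1 (fun k => k%:R : R)) := cardsUI (B a) (\bigcup_(j <- s) B j).
rewrite !natrD -natr1.
have := hV a (mem_head _ _).
by move: IH; nra.
Qed.

Lemma card_bigcup_seq_le (I : Type) (T : finType) (B : I -> {set T}) (s : seq I) (V : nat) :
  (forall j, #|B j| <= V)%N -> (#|\bigcup_(j <- s) B j| <= size s * V)%N.
Proof.
move=> hB; elim: s => [|a s IH]; first by rewrite big_nil cards0.
by rewrite big_cons (leq_trans (leq_card_setU _ _)) // mulSn leq_add.
Qed.

(** * Ball volumes and existence of codes *)

Lemma card_template n : #|{: template n}| = (2 ^ n)%N.
Proof. by rewrite card_ffun card_bool card_ord. Qed.

(** Translation by [t + u] is a Hamming isometry exchanging the two centres. *)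
Lemma card_ball n eps (t u : template n) : #|ball_set n eps t| = #|ball_set n eps u|.
Proof.
pose f (y : template n) : template n := [ffun i => y i (+) (t i (+) u i)].
have fK : involutive f by move=> y; apply/ffunP => i; rewrite !ffunE -addbA addbb addbF.
rewrite -(card_imset _ (inv_inj fK)); apply: eq_card => y.
apply/imsetP/idP => [[z + ->]|]; rewrite !inE /in_ball => Hz.
  suff -> : ham u (f z) = ham t z by [].
  rewrite !hamE; apply: eq_bigr => i _; rewrite ffunE.
  by case: (u i) (t i) (z i) => [] [] [].
exists (f y); rewrite ?fK // inE /in_ball.
suff -> : ham t (f y) = ham u y by [].
rewrite !hamE; apply: eq_bigr => i _; rewrite ffunE.
by case: (u i) (t i) (y i) => [] [] [].
Qed.

(** Flipping [t] on the [eps]-subsets of coordinates yields distinct points at distance [eps]. *)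
Lemma card_ball_ge n eps (t : template n) : ('C(n, eps) <= #|ball_set n eps t|)%N.
Proof.
rewrite -[n in 'C(n, _)]card_ord -card_draws.
pose f (A : {set 'I_n}) : template n := [ffun i => t i (+) (i \in A)].
have fI : injective f.
  move=> A B /ffunP AB; apply/setP => i; have := AB i; rewrite !ffunE.
  by case: (t i) (i \in A) (i \in B) => [] [] [].
rewrite -(card_imset _ fI); apply/subset_leq_card/fintype.subsetP => y /imsetP[A].
rewrite inE => /eqP cA ->; rewrite inE /in_ball -cA; apply/subset_leq_card/fintype.subsetP.
by move=> i; rewrite inE ffunE; case: (t i) (i \in A) => [] [].
Qed.

(** The antipode of [t] lies at distance [n]. This serves the case [N = 2], where a single ball must
    not cover the space. *)
Lemma card_ball_lt n eps (t : template n) : (eps < n)%N ->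
  (#|ball_set n eps t| < 2 ^ n)%N.
Proof.
move=> en; rewrite -card_template -cardsT; apply: proper_card.
rewrite finset.properEneq finset.subsetT andbT; apply/eqP => /setP /(_ [ffun i => ~~ t i]).
rewrite !inE /in_ball hamE (eq_bigr (fun=> 1%N)) => [|i _]; last first.
  by rewrite ffunE; case: (t i).
by rewrite sum1_card card_ord leqNgt en.
Qed.

(* Gilbert-Varshamov: codewords can be added greedily while balls do not cover. *)
Lemma exists_code n eps V M :
  (forall t, #|ball_set n eps t| <= V)%N -> (M.-1 * V < 2 ^ n)%N ->
  exists v : 'I_M -> template n, forall i j, i != j -> ~~ in_ball eps (v i) (v j).
Proof.
move=> hV; case: M => [|M]; first by move=> _; exists (fun i => [ffun _ => true]) => -[].
move=> hM.
suff [s ss ps] : exists2 s : seq (template n), size s = M.+1 &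
    pairwise (fun t u => ~~ in_ball eps t u) s.
  have in_sym t u : in_ball eps t u = in_ball eps u t by rewrite /in_ball ham_sym.
  pose d : template n := [ffun _ => true].
  exists (fun i : 'I_M.+1 => nth d s i) => i j ij.
  wlog lij : i j ij / (i < j)%N.
    move=> W; have := ij; rewrite -(inj_eq val_inj) neq_ltn => /orP[/W|]; first exact.
    by rewrite in_sym; apply: W; rewrite eq_sym.
  by move/(pairwiseP d): ps; apply => //; rewrite inE ss.
move: hM; elim: M => [|M IH] hM.
  by exists [:: [ffun _ => true]].
have [|s ss ps] := IH; first by apply: leq_ltn_trans hM; rewrite leq_mul2r leqnSn orbT.
have : (#|\bigcup_(t <- s) ball_set n eps t| < #|{: template n}|)%N.
  by rewrite card_template; apply: leq_ltn_trans hM; rewrite /= -ss card_bigcup_seq_le.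
rewrite -cardsT => lt.
have /set0Pn[u] : [set: template n] :\: \bigcup_(t <- s) ball_set n eps t != finset.set0.
  by rewrite -card_gt0 cardsD finset.setTI subn_gt0.
rewrite inE finset.in_setT andbT => uN; exists (u :: s); first by rewrite /= ss.
rewrite /= ps andbT; apply/allP => t ts; apply: contra uN => ut.
by rewrite (big_rem t ts) finset.in_setU inE /in_ball ham_sym -/(in_ball _ _ _) ut.
Qed.

(** * The conditional hitting probabilities *)

(** One coordinate of a uniform function is uniform, in multiplicative form: the indicator is a
    product over coordinates, so the sum over functions distributes. *)
Lemma card_ffun_coord (I T : finType) (k : I) (U : {set T}) :
  (#|[set f : {ffun I -> T} | f k \in U]| * #|T| = #|U| * #|{ffun I -> T}|)%N.
Proof.
have -> : #|[set f : {ffun I -> T} | f k \in U]| =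
    (\sum_(f : {ffun I -> T}) \prod_i (if i == k then f i \in U else true))%N.
  rewrite -sum1_card big_mkcond /=; apply: eq_bigr => f _.
  rewrite (bigD1 k) //= eqxx big1 => [|i /negbTE ->//].
  by rewrite inE muln1; case: ifP.
rewrite -(bigA_distr_bigA (fun i t => nat_of_bool (if i == k then t \in U else true))).
rewrite (bigD1 k) //= eqxx (_ : \sum_(j : T) _ = #|U|)%N; last first.
  by rewrite -sum1_card [RHS]big_mkcond /=; apply: eq_bigr => t _; case: ifP.
rewrite (eq_bigr (fun=> #|T|)) => [|i /negbTE ->]; last by rewrite sum1_card.
by rewrite -mulnA prod_nat_const cardC1 -expnSr prednK ?card_ffun //; apply/card_gt0P; exists k.
Qed.

Definition codes n N eps : {set {ffun 'I_N -> template n}} :=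
  [set v : {ffun 'I_N -> template n} |
    [forall i, forall j, (i != j) ==> ~~ in_ball eps (v i) (v j)]].

Definition covered n N eps (v : {ffun 'I_N -> template n}) (k : 'I_N) :=
  \bigcup_(j in predC1 k) ball_set n eps (v j).

Lemma codesE n N eps : ~: W0 n N eps = finset.setX (codes n N eps) [set: _].
Proof.
apply/finset.setP => -[v v']; rewrite !inE andbT /= negb_exists.
apply: eq_forallb => i; rewrite negb_exists; apply: eq_forallb => j.
by rewrite negb_and implybE negbK.
Qed.

Section average.
Context {R : realType} (n N eps : nat) (k : 'I_N).

Lemma p_kE : p_k R n eps k =
  (\sum_(v in codes n N eps) #|covered n N eps v k|)%N%:R
    / (#|codes n N eps|%:R * 2 ^+ n).
Proof.
have F0 : #|{ffun 'I_N -> template n}|%:R != 0 :> R.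
  by rewrite pnatr_eq0 card_ffun expn_eq0 card_template expn_eq0.
(* For a fixed code the template [v' k] is still uniform, so [card_ffun_coord] counts the hits code
   by code. *)
have E : (#|hit n eps k :&: ~: W0 n N eps| * 2 ^ n =
   (\sum_(v in codes n N eps) #|covered n N eps v k|) * #|{ffun 'I_N -> template n}|)%N.
  rewrite -card_template big_distrl /= (eq_bigr _ (fun v _ => esym (card_ffun_coord _ _ k _))).
  rewrite -big_distrl /=; congr muln.
  rewrite codesE -sum1_card (eq_bigl (fun w : Omega n N => (w.1 \in codes n N eps) &&
    (w.2 k \in covered n N eps w.1 k))); last first.
    move=> [v v']; rewrite !inE andbT andbC; congr andb.
    apply/existsP/bigcupP => -[j].
      by case/andP=> jk jb; exists j; rewrite ?inE.
    by rewrite !inE => jk jb; exists j; rewrite jk.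
  rewrite -(pair_big_dep (fun v => v \in codes n N eps)
    (fun v (v' : {ffun 'I_N -> template n}) => v' k \in covered n N eps v k)
    (fun _ _ => 1%N)) /=.
  by apply: eq_bigr => v _; rewrite -sum1_card; apply: eq_bigl => v'; rewrite inE.
have {}E : #|hit n eps k :&: ~: W0 n N eps|%:R =
   (\sum_(v in codes n N eps) #|covered n N eps v k|)%N%:R
   * #|{ffun 'I_N -> template n}|%:R / 2 ^+ n :> R.
  by rewrite -natrM -E natrM natrX mulfK // expf_neq0.
rewrite /p_k /condPr /Pr E codesE cardsX cardsT card_prod !natrM.
set A := _%:R; set F := _%:R in F0 *; set G := #|codes _ _ _|%:R.
(* Without codes both sides are 0, since dividing by 0 gives 0. *)
have [->|G0] := eqVneq G 0; first by rewrite !(mul0r, invr0, mulr0).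
by field; rewrite F0 G0 expf_neq0.
Qed.

Lemma p_k_bounds (lo hi : R) : (0 < #|codes n N eps|)%N ->
  (forall v, v \in codes n N eps -> lo <= #|covered n N eps v k|%:R <= hi) ->
  lo / 2 ^+ n <= p_k R n eps k <= hi / 2 ^+ n.
Proof.
move=> G0 H; have GR : 0 < #|codes n N eps|%:R :> R by rewrite ltr0n.
rewrite p_kE invfM mulrA !ler_pM2r ?invr_gt0 ?exprn_gt0 //.
rewrite ler_pdivlMr // ler_pdivrMr // -sum1_card !natr_sum !mulr_sumr.
by apply/andP; split; apply: ler_sum => v /H /andP[]; rewrite mulr1.
Qed.
End average.

(** * Lower bound on binomial coefficients *)

Section central.
Context {R : realFieldType}.

(* Truncating at second order would be too weak for [succ_ratio_exp_step]. *)
Lemma bernoulli3 (z : R) m : 0 <= z ->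
  1 + m%:R * z + m%:R * (m%:R - 1) / 2 * z ^+ 2
    + m%:R * (m%:R - 1) * (m%:R - 2) / 6 * z ^+ 3 <= (1 + z) ^+ m.
Proof.
move=> z0; elim: m => [|m IH]; first by rewrite expr0; lra.
have z1 : 0 <= 1 + z by lra.
rewrite [(1 + z) ^+ _]exprS; apply: le_trans (ler_wpM2l z1 IH).
rewrite -natr1 -subr_ge0.
set a := m%:R.
(* All that remains is one term in [z ^+ 4], whose coefficient is a product of three consecutive
   integers over 6. *)
rewrite (_ : _ - _ = a * (a - 1) * (a - 2) / 6 * z ^+ 4); last by field.
rewrite mulr_ge0 ?exprn_ge0 // /a; case: m {IH a} => [|[|m]];
  rewrite ?mulr0 ?mul0r ?subrr ?mulr0 ?mul0r //.
Qed.

(** With [c = m + 1] and [z = 1 / (c ^ 2 - 1)], the ratio [c / (c - 1)] equals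
    [(c + 1) / c * (1 + z)]. The claim becomes [((c + 1) / c) ^ 2 <= (1 + z) ^ (2 c - 1)], which
    [bernoulli3] reduces to a polynomial inequality for [c >= 2]. *)
Lemma succ_ratio_exp_step m : (0 < m)%N ->
  ((m.+1%:R + 1) / m.+1%:R) ^+ (2 * m.+1).+1 <= ((m%:R + 1) / m%:R) ^+ (2 * m).+1 :> R.
Proof.
move=> m0.
pose c : R := m%:R + 1.
have c2 : 2 <= c by rewrite /c natr1 ler_nat.
have -> : m.+1%:R = c by rewrite -natr1.
have mE : m%:R = c - 1 by rewrite /c addrK.
have -> : (m%:R + 1) / m%:R = ((c + 1) / c) * (1 + (c ^+ 2 - 1)^-1).
  by rewrite mE; field; rewrite !lt0r_neq0 //; nra.
rewrite [leRHS]exprMn (_ : (2 * m.+1).+1 = 2 + (2 * m).+1)%N; last by lia.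
rewrite exprD [leLHS]mulrC. rewrite ler_wpM2l ?exprn_ge0 ?divr_ge0 //; try lra.
have z0 : 0 <= (c ^+ 2 - 1)^-1 by rewrite invr_ge0; nra.
apply: le_trans (bernoulli3 _ (2 * m).+1 z0).
have -> : (2 * m).+1%:R = 2 * c - 1 :> R by rewrite -addn1 natrD natrM mE; ring.
rewrite -subr_ge0.
rewrite (_ : _ - _ = (c ^+ 4 + c ^+ 3 + 9 * c ^+ 2 - 9 * c - 3) /
   (3 * c ^+ 2 * (c - 1) ^+ 2 * (c + 1) ^+ 3)); last first.
  by field; rewrite !lt0r_neq0 //; nra.
apply: divr_ge0; last by rewrite !mulr_ge0 ?exprn_ge0 //; lra.
have : 0 <= c ^+ 3 by rewrite exprn_ge0; lra.
have : 0 <= c ^+ 4 by rewrite exprn_ge0; lra.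
nra.
Qed.

Lemma succ_ratio_exp_le m p : (0 < m <= p)%N ->
  ((p%:R + 1) / p%:R) ^+ (2 * p).+1 <= ((m%:R + 1) / m%:R) ^+ (2 * m).+1 :> R.
Proof.
case/andP=> m0; elim: p => [|p IH]; first by rewrite leqn0 => /eqP <-.
rewrite leq_eqVlt => /predU1P[<-//|mp].
by apply: le_trans (IH mp); apply: succ_ratio_exp_step; exact: leq_trans m0 mp.
Qed.

(* Stirling-free: in the induction on [b] the ratio of both sides is the quotient of
   the decreasing sequence [((m + 1) / m) ^ (2 m + 1)] at [m = b] and [m = a + b],
   and the base case [b = 1] compares it at [m = a] with its value 8 at [m = 1]. *)
Lemma bin_ge_entropy a b : (0 < a)%N -> (0 < b)%N ->
  (a + b)%:R ^+ (2 * (a + b)).+1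
    <= 'C(a + b, a)%:R ^+ 2 * 8 * a%:R ^+ (2 * a).+1 * b%:R ^+ (2 * b).+1 :> R.
Proof.
move=> a0; have aR : 0 < a%:R :> R by rewrite ltr0n.
case: b => // b _; elim: b => [|b IH].
  rewrite addn1 binSn (_ : (2 * a.+1).+1 = 2 + (2 * a).+1)%N; last by lia.
  rewrite exprD expr1n mulr1 -mulrA ler_wpM2l ?exprn_ge0 //.
  have := @succ_ratio_exp_le 1 a; rewrite a0 => /(_ isT).
  rewrite expr_div_n ler_pdivrMr ?exprn_gt0 // natr1 divr1.
  by rewrite (_ : (1 + 1) ^+ (2 * 1).+1 = 8 :> R) //; ring.
move: b.+1 (ltn0Sn b) IH => b' b0 IH {b}.
have bR : 0 < b'%:R :> R by rewrite ltr0n.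
have [s sE] : {s | s = a + b'}%N by eexists.
have s0 : 0 < s%:R :> R by rewrite ltr0n sE addn_gt0 a0.
have H : (s.+1)%:R * 'C(s, a)%:R = (b'.+1)%:R * 'C(s.+1, a)%:R :> R.
  rewrite -!natrM; congr (_%:R); rewrite -[s in LHS]/(s.+1.-1) mul_bin_down.
  by congr muln; rewrite sE; lia.
rewrite addnS -sE in IH *.
rewrite (_ : (2 * s.+1).+1 = 2 + (2 * s).+1)%N; last by lia.
rewrite (_ : (2 * b'.+1).+1 = 2 + (2 * b').+1)%N; last by lia.
rewrite !exprD.
set w := a%:R ^+ _; set z := b'.+1%:R ^+ (2 * b').+1.
rewrite [leRHS](_ : _ = s.+1%:R ^+ 2 * ('C(s, a)%:R ^+ 2 * 8 * w * z)); last first.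
  transitivity ((s.+1%:R * 'C(s, a)%:R) ^+ 2 * (8 * w * z)); last by ring.
  by rewrite H; ring.
rewrite ler_wpM2l ?exprn_ge0 //.
have := @succ_ratio_exp_le b' s; rewrite {1}sE leq_addl b0 => /(_ isT).
rewrite !natr1 expr_div_n ler_pdivrMr ?exprn_gt0 // => /le_trans; apply.
rewrite mulrC; apply: le_trans (ler_wpM2r _ IH) _; first by rewrite exprn_ge0 // divr_ge0.
rewrite expr_div_n -!mulrA !ler_wpM2l ?exprn_ge0 // mulrCA.
by rewrite divff ?mulr1 // expf_neq0 // lt0r_neq0.
Qed.
End central.

(** * Logarithms and the number of rounds *)

Section logs.
Context {R : realType}.
Implicit Types (x y t : R).

Lemma ln_le_sub1 x : 0 < x -> ln x <= x - 1.
Proof.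
move=> x0; rewrite [x in ln x](_ : x = 1 + (x - 1)); last by ring.
by apply: le_trans (le_ln1Dx _) _; lra.
Qed.

Lemma ln_ge_1sub x : 0 < x -> 1 - x^-1 <= ln x.
Proof.
move=> x0; have := @ln_le_sub1 x^-1; rewrite invr_gt0 lnV ?posrE // => /(_ x0); lra.
Qed.

Lemma ln2_bounds : 1 / 2 <= ln (2 : R) <= 1.
Proof.
have := @ln_le_sub1 2 (ltr0n _ 2); have := @ln_ge_1sub 2 (ltr0n _ 2); lra.
Qed.

Lemma powR32E t : (3 / 2 : R) `^ t = expR (t * ln (3 / 2)).
Proof. by rewrite /powR ifF //; apply/negbTE/lt0r_neq0; lra. Qed.

Lemma ln32_ge : 1 / 3 <= ln (3 / 2 : R).
Proof. by have := @ln_ge_1sub (3 / 2); rewrite invf_div; lra. Qed.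

(** Factoring out [(3 / 2) ^+ k] leaves [(3 / 2) ^ (t - k) >= 1 + (t - k) / 3]; the three lines for
    [k = 2, 3, 4] together dominate the left side. *)
Lemma powR32_ge_lin t : 2 <= t -> 3 / 2 * (t - 1) <= (3 / 2) `^ t.
Proof.
move=> t2.
have H k : k%:R <= t -> (3 / 2) ^+ k * (1 + (t - k%:R) / 3) <= (3 / 2) `^ t :> R.
  move=> kt; rewrite -[t in leRHS](subrK k%:R) [in leRHS]addrC powRD; last first.
    by apply/implyP => _; apply: lt0r_neq0; lra.
  rewrite powR_mulrn; last by lra.
  rewrite ler_wpM2l ?exprn_ge0 //.
  rewrite powR32E; apply: le_trans (expR_ge1Dx _).
  by rewrite lerD2l; have := ln32_ge; nra.
have [t3|t3] := leP t 3.
  by have := H 2%N t2; nra.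
have [t4|t4] := leP t 4.
  by have := H 3%N (ltW t3); nra.
by have := H 4%N (ltW t4); nra.
Qed.

(** The cube root of the power is at least [1 + t / 9], whence the constant [729 = 9 ^ 3]. *)
Lemma powR32_ge_cube t : 1 <= t -> (t - 1) ^+ 3 <= 729 * (3 / 2) `^ t.
Proof.
move=> t1.
have -> : (3 / 2) `^ t = expR (t * ln (3 / 2) / 3) ^+ 3 :> R.
  by rewrite -expRM_natl powR32E; congr expR; field.
rewrite (_ : 729 = 9 ^+ 3 :> R); last by ring.
rewrite -exprMn; apply: lerXn2r; rewrite ?nnegrE ?mulr_ge0 ?expR_ge0 //; first by lra.
have := expR_ge1Dx (t * ln (3 / 2) / 3 : R); have := ln32_ge; nra.
Qed.

Lemma ln_prod_1B N (p : 'I_N -> R) : (forall k, p k < 1) ->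
  ln (\prod_(k < N) (1 - p k)) = \sum_(k < N) ln (1 - p k).
Proof.
move=> p1.
suff [] : 0 < \prod_(k < N) (1 - p k) /\
  ln (\prod_(k < N) (1 - p k)) = \sum_(k < N) ln (1 - p k) by [].
apply: (big_rec2 (fun a b => 0 < a /\ ln a = b)); first by rewrite ln1.
move=> k a b _ [b0 <-]; have pk : 0 < 1 - p k by rewrite subr_gt0.
by rewrite mulr_gt0 // lnM ?posrE.
Qed.

Lemma sum_ln_1B_lt0 N (p : 'I_N -> R) : (0 < N)%N -> (forall k, 0 < p k < 1) ->
  \sum_(k < N) ln (1 - p k) < 0.
Proof.
case: N p => // N p _ hp; rewrite big_ord_recl /=.
have hl k : ln (1 - p k) < 0.
  by have /andP[? ?] := hp k; apply: le_lt_trans (ln_le_sub1 _ _) _; lra.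
rewrite -[ltRHS]addr0; apply: ltr_leD => //; apply: sumr_le0 => k _; exact: ltW.
Qed.

(** Covers large hitting probabilities, which [rounds_ge] excludes. *)
Lemma rounds_ge1 N (p : 'I_N -> R) : (0 < N)%N -> (forall k, 0 < p k < 1) ->
  1 <= (Num.ceil (- ln 2 / ln (\prod_(k < N) (1 - p k))))%:~R :> R.
Proof.
move=> N0 hp; rewrite ln_prod_1B; last by move=> k; have /andP[] := hp k.
rewrite ler1z -gtz0_ge1 ceil_gt0 ltr_ndivlMr ?mul0r ?sum_ln_1B_lt0 //.
by have /andP[] := ln2_bounds; lra.
Qed.

(** From [- ln (1 - p) >= p] and [ln 2 <= 1]; the summand 1 pays for the ceiling. *)
Lemma rounds_le N (p : 'I_N -> R) lo : (0 < N)%N -> 0 < lo ->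
  (forall k, lo <= p k < 1) ->
  (Num.ceil (- ln 2 / ln (\prod_(k < N) (1 - p k))))%:~R <= (N%:R * lo)^-1 + 1 :> R.
Proof.
move=> N0 lo0 hp; rewrite ln_prod_1B; last by move=> k; have /andP[] := hp k.
have NR : 0 < N%:R :> R by rewrite ltr0n.
have S : N%:R * lo <= - \sum_(k < N) ln (1 - p k).
  rewrite -sumrN mulr_natl -[X in _ *+ X]card_ord -sumr_const; apply: ler_sum => k _.
  have /andP[h1 h2] := hp k; have := @ln_le_sub1 (1 - p k); lra.
have S0 : 0 < - \sum_(k < N) ln (1 - p k) by apply: lt_le_trans S; rewrite mulr_gt0.
have /andP[] := ceil_itv (- ln 2 / \sum_(k < N) ln (1 - p k)).
rewrite intrB => + _; set m := _%:~R.
suff : - ln 2 / \sum_(k < N) ln (1 - p k) <= (N%:R * lo)^-1 by lra.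
rewrite mulNr -mulrN -invrN ler_pdivrMr // mulrC ler_pdivlMr ?mulr_gt0 //.
apply: le_trans S; rewrite ler_piMl //; last by case/andP: ln2_bounds.
by rewrite mulr_ge0 // ltW.
Qed.

(** For [p <= 1 / 2] one has [- ln (1 - p) <= 2 p]; with [ln 2 >= 1 / 2] this gives the constant
    4. *)
Lemma rounds_ge N (p : 'I_N -> R) hi : (0 < N)%N -> hi <= 1 / 2 ->
  (forall k, 0 < p k <= hi) ->
  (4 * N%:R * hi)^-1 <= (Num.ceil (- ln 2 / ln (\prod_(k < N) (1 - p k))))%:~R :> R.
Proof.
move=> N0 hi2 hp.
have p1 k : 0 < p k < 1 by have := hp k; lra.
rewrite ln_prod_1B; last by move=> k; have := p1 k; lra.
have NR : 0 < N%:R :> R by rewrite ltr0n.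
apply: le_trans (ceil_ge _).
have S0 : 0 < - \sum_(k < N) ln (1 - p k) by rewrite oppr_gt0 sum_ln_1B_lt0.
have S : - \sum_(k < N) ln (1 - p k) <= 2 * N%:R * hi.
  rewrite -sumrN mulrAC mulr_natr -[X in _ *+ X]card_ord -sumr_const; apply: ler_sum => k _.
  have /andP[h1 h2] := hp k; have q0 : 0 < 1 - p k by lra.
  have := @ln_ge_1sub (1 - p k) q0.
  have : (1 - p k)^-1 <= 1 + 2 * p k by rewrite -div1r ler_pdivrMr //; nra.
  lra.
rewrite mulNr -mulrN -invrN ler_pdivlMr // mulrC ler_pdivrMr; last by lra.
have /andP[l1 _] := ln2_bounds.
nra.
Qed.
End logs.

(** * Entropy and packing estimates *)

Section entropy.
Context {R : realType}.

Lemma powR2E (t : R) : 2 `^ t = expR (t * ln 2).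
Proof. by rewrite /powR ifF //; apply/negbTE/lt0r_neq0. Qed.

Lemma powR2_log2 k (a : R) : 0 < a -> 2 `^ (k%:R * log2 a) = a ^+ k.
Proof.
move=> a0; have l2 : 0 < ln (2 : R) by have := @ln2_bounds R; lra.
rewrite powR2E /log2 -mulrA divfK ?lt0r_neq0 // expRM_natl lnK //.
Qed.

Lemma powR2_entropy a b : (0 < a)%N -> (0 < b)%N ->
  2 `^ ((a + b)%:R * hbin (a%:R / (a + b)%:R)) =
  (a + b)%:R ^+ (a + b) / (a%:R ^+ a * b%:R ^+ b) :> R.
Proof.
move=> a0 b0; have l2 : 0 < ln (2 : R) by have := @ln2_bounds R; lra.
have aR : 0 < a%:R :> R by rewrite ltr0n.
have bR : 0 < b%:R :> R by rewrite ltr0n.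
have nR : 0 < (a + b)%:R :> R by rewrite ltr0n addn_gt0 a0.
have E : 1 - a%:R / (a + b)%:R = b%:R / (a + b)%:R :> R.
  by apply: (mulIf (lt0r_neq0 nR)); rewrite mulrBl !divfK ?lt0r_neq0 // natrD; ring.
rewrite powR2E -[RHS]lnK ?posrE ?divr_gt0 ?mulr_gt0 ?exprn_gt0 //; congr expR.
rewrite ln_div ?posrE ?mulr_gt0 ?exprn_gt0 // lnM ?posrE ?exprn_gt0 // !lnXn //.
rewrite /hbin /log2 E !ln_div ?posrE //.
rewrite -[_ *+ a]mulr_natl -[_ *+ b]mulr_natl -[_ *+ (a + b)]mulr_natl.
by rewrite natrD; field; rewrite -natrD !lt0r_neq0.
Qed.

(** The right side is the bound of [card_ball_weight] at its optimal weight [y = a / b]. *)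
Lemma ratio_pow_entropy a b : (0 < a)%N -> (0 < b)%N ->
  (a + b)%:R ^+ (a + b) / (a%:R ^+ a * b%:R ^+ b)
   = (1 + a%:R / b%:R) ^+ (a + b) / (a%:R / b%:R) ^+ a :> R.
Proof.
move=> a0 b0.
have aR : a%:R != 0 :> R by rewrite pnatr_eq0 -lt0n.
have bR : b%:R != 0 :> R by rewrite pnatr_eq0 -lt0n.
rewrite (_ : 1 + _ = (a + b)%:R / b%:R); last by rewrite natrD; field.
rewrite !expr_div_n [b%:R ^+ (a + b)]exprD; field.
by rewrite !expf_neq0.
Qed.

(** The square root of [bin_ge_entropy], as [8 a (1 - a / n) = 8 a b / n]. *)
Lemma bin_ge_entropy_sqrt a b : (0 < a)%N -> (0 < b)%N ->
  (a + b)%:R ^+ (a + b) / (a%:R ^+ a * b%:R ^+ b)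
    / Num.sqrt (8 * a%:R * (1 - a%:R / (a + b)%:R)) <= 'C(a + b, a)%:R :> R.
Proof.
move=> a0 b0.
have aR : 0 < a%:R :> R by rewrite ltr0n.
have bR : 0 < b%:R :> R by rewrite ltr0n.
have nR : 0 < (a + b)%:R :> R by rewrite ltr0n addn_gt0 a0.
have E : 8 * a%:R * (1 - a%:R / (a + b)%:R) = 8 * a%:R * b%:R / (a + b)%:R :> R.
  by rewrite natrD; field; rewrite -natrD lt0r_neq0.
have s0 : 0 < 8 * a%:R * b%:R / (a + b)%:R :> R by rewrite divr_gt0 ?mulr_gt0.
rewrite E ler_pdivrMr ?sqrtr_gt0 //.
rewrite -(@ler_pXn2r _ 2) ?nnegrE ?mulr_ge0 ?invr_ge0 ?sqrtr_ge0 ?mulr_ge0 ?exprn_ge0 //.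
rewrite [leRHS]exprMn sqr_sqrtr ?(ltW s0) // expr_div_n ler_pdivrMr; last first.
  by rewrite exprn_gt0 // mulr_gt0 // exprn_gt0.
rewrite -(ler_pM2r nR).
rewrite [leLHS](_ : _ = (a + b)%:R ^+ (2 * (a + b)).+1); last first.
  by rewrite [RHS]exprSr [(2 * _)%N]mulnC exprM.
rewrite [leRHS](_ : _ = 'C(a + b, a)%:R ^+ 2 * 8 * a%:R ^+ (2 * a).+1 * b%:R ^+ (2 * b).+1).
  exact: bin_ge_entropy.
rewrite !exprSr ![(2 * _)%N]mulnC !exprM.
move: (a%:R ^+ a) (b%:R ^+ b) => u v.
by field; rewrite -natrD lt0r_neq0.
Qed.

Lemma ceil_half k : (Num.ceil ((k%:R + 1) / 2 : R)) = (k./2).+1.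
Proof.
apply: ceil_def; rewrite intrB -!pmulrn -[(k./2).+1%:R]natr1.
have -> : k%:R = (odd k)%:R + 2 * (k./2)%:R :> R.
  by rewrite -[in LHS](odd_double_half k) natrD -mul2n natrM.
by case: (odd k) => /=; lra.
Qed.

(* [3 ^+ a * (4 / 3) ^+ (a + b)] is the Chernoff bound on the volume of a ball of
   radius [a] in dimension [a + b] obtained by tilting with weight 1/3. *)
Section packing.
Context (M a b : nat) (a0 : (0 < a)%N) (ab : (a <= b)%N).
Let y : R := a%:R / b%:R.
Let t : R := (a + b)%:R / a%:R.
Context (HM : M%:R * 2 ^+ a * y ^+ (a./2).+1 < 1).

Let aR : 0 < a%:R :> R. Proof. by rewrite ltr0n. Qed.
Let bR : 0 < b%:R :> R. Proof. by rewrite ltr0n (leq_trans a0). Qed.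
Let tE : t = 1 + y^-1.
Proof. by rewrite /t /y natrD; field; rewrite !lt0r_neq0. Qed.
Let t1E : t - 1 = y^-1. Proof. by rewrite tE; ring. Qed.
Let y0 : 0 < y. Proof. by rewrite divr_gt0. Qed.
Let y1 : 1 <= y^-1.
Proof. by rewrite invf_div ler_pdivlMr // mul1r ler_nat. Qed.
Let t2 : 2 <= t. Proof. by rewrite tE; have := y1; lra. Qed.
Let powt : ((3 / 2) `^ t) ^+ a = (3 / 2) ^+ (a + b) :> R.
Proof.
rewrite -!powR_mulrn ?powR_ge0 ?divr_ge0 // -powRrM; congr powR.
by rewrite /t divfK // lt0r_neq0.
Qed.
Let HM' : M%:R * 2 ^+ a < y^-1 ^+ (a./2).+1.
Proof. by have := HM; rewrite -ltr_pdivlMr ?exprVn ?exprn_gt0 // div1r. Qed.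

(** By [HM], [M 2 ^ a < (1 / y) ^ a]. Since [t - 1 = 1 / y] and [t a = n], [powR32_ge_lin] raised to
    the power [a] gives [(3 / 2 / y) ^ a <= (3 / 2) ^ n]; finally [2 = 3 / 2 * (4 / 3)]. *)
Lemma packing_lt : M%:R * (3 ^+ a * (4 / 3) ^+ (a + b)) < 2 ^+ (a + b) :> R.
Proof.
have H1 : M%:R * 2 ^+ a < y^-1 ^+ a.
  by apply: lt_le_trans HM' _; apply: ler_weXn2l => //; lia.
have H2 : (3 / 2 * y^-1) ^+ a <= (3 / 2) ^+ (a + b).
  rewrite -powt lerXn2r ?nnegrE ?powR_ge0 ?mulr_ge0 ?invr_ge0 ?(ltW y0) //.
  by rewrite -t1E powR32_ge_lin.
have -> : 2 ^+ (a + b) = (3 / 2) ^+ (a + b) * (4 / 3) ^+ (a + b) :> R.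
  by rewrite -exprMn; congr (_ ^+ _); field.
rewrite mulrA ltr_pM2r ?exprn_gt0 ?divr_gt0 //.
apply: lt_le_trans H2; rewrite exprMn expr_div_n.
by rewrite [ltLHS]mulrC -mulrA ltr_pM2l ?exprn_gt0 // [ltRHS]mulrC ltr_pdivlMr ?exprn_gt0.
Qed.

(** Squaring [HM] leaves up to [a + 2] factors [r = 1 / y]. Three of them are absorbed by
    [r ^ 3 <= 729 q], the other [a - 1] by [3 r <= 4 q]. *)
Lemma packing_sqr_le :
  M%:R ^+ 2 * (3 ^+ a * (4 / 3) ^+ (a + b)) <= 729 * 2 ^+ (a + b) :> R.
Proof.
pose r := y^-1; pose q : R := (3 / 2) `^ t.
have r1 : 1 <= r := y1.
have H1 : (M%:R * 2 ^+ a) ^+ 2 <= r ^+ a.+2.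
  apply: (@le_trans _ _ ((r ^+ (a./2).+1) ^+ 2)).
    by rewrite lerXn2r ?nnegrE ?mulr_ge0 ?exprn_ge0 ?invr_ge0 ?(ltW y0) // ltW.
  by rewrite -exprM; apply: ler_weXn2l => //; lia.
have q0 : 0 <= q by rewrite powR_ge0.
have Hr : 3 / 2 * r <= q.
  by rewrite /r -t1E powR32_ge_lin.
have Hr3 : r ^+ 3 <= 729 * q.
  by rewrite /r -t1E powR32_ge_cube // (le_trans _ t2) // ler1n.
have -> : 2 ^+ (a + b) = (3 / 2) ^+ (a + b) * (4 / 3) ^+ (a + b) :> R.
  by rewrite -exprMn; congr (_ ^+ _); field.
rewrite !mulrA ler_pM2r ?exprn_gt0 ?divr_gt0 // -powt -/q.
rewrite -(ler_pM2r (x := 4 ^+ a)) ?exprn_gt0 //.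
rewrite [leLHS](_ : _ = (M%:R * 2 ^+ a) ^+ 2 * 3 ^+ a); last first.
  have -> : 4 ^+ a = (2 ^+ a) ^+ 2 :> R by rewrite -exprM mulnC exprM; congr (_ ^+ _); ring.
  by move: (2 ^+ a) (3 ^+ a) => u v; ring.
apply: (@le_trans _ _ (r ^+ a.+2 * 3 ^+ a)).
  by rewrite ler_wpM2r ?exprn_ge0.
have H2 : (3 * r) ^+ a.-1 <= (4 * q) ^+ a.-1.
  by rewrite lerXn2r ?nnegrE ?mulr_ge0 //; lra.
have -> : r ^+ a.+2 * 3 ^+ a = 3 * r ^+ 3 * (3 * r) ^+ a.-1.
  by rewrite -[in LHS](prednK a0) exprMn !exprS; ring.
have -> : 729 * q ^+ a * 4 ^+ a = 729 * q * 4 * (4 * q) ^+ a.-1.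
  by rewrite -[in LHS](prednK a0) exprMn !exprS; ring.
apply: ler_pM => //; rewrite ?mulr_ge0 ?exprn_ge0 ?mulr_ge0 //; lra.
Qed.
End packing.
End entropy.

(** * Bounds on the hitting probabilities and the median *)

Section covered_bounds.
Context {R : realType} (n N eps : nat).
Implicit Types (v : {ffun 'I_N -> template n}) (k : 'I_N).

Lemma coveredE v k :
  covered n N eps v k = \bigcup_(j <- enum (predC1 k)) ball_set n eps (v j).
Proof. by rewrite big_enum. Qed.

Lemma size_enum_predC1 k : size (enum (predC1 k)) = N.-1.
Proof. by rewrite -cardE cardC1 card_ord. Qed.

Lemma card_covered_le v k (t : template n) :
  (#|covered n N eps v k| <= N.-1 * #|ball_set n eps t|)%N.
Proof.
rewrite coveredE -(size_enum_predC1 k) card_bigcup_seq_le // => j.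
by rewrite (card_ball n eps (v j) t).
Qed.

Lemma card_covered_ge v k (t : template n) (D : R) : (0 < N)%N -> v \in codes n N eps ->
  (forall t u, (eps < ham t u)%N -> #|ball_set n eps t :&: ball_set n eps u|%:R <= D) ->
  (N%:R - 1) * (#|ball_set n eps t|%:R - (N%:R - 2) * D / 2) <= #|covered n N eps v k|%:R.
Proof.
move=> N0; rewrite inE => /forallP vC HD.
have := @bonferroni_le R _ _ (fun j => ball_set n eps (v j))
  (enum (predC1 k)) (#|ball_set n eps t|%:R) D (enum_uniq _).
rewrite -coveredE size_enum_predC1.
have -> : N.-1%:R = N%:R - 1 :> R by rewrite -[in RHS](prednK N0) -natr1 addrK.
have h1 j : j \in enum (predC1 k) -> #|ball_set n eps t|%:R <= #|ball_set n eps (v j)|%:R :> R.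
  by move=> _; rewrite (card_ball n eps (v j) t).
have h2 i j : i \in enum (predC1 k) -> j \in enum (predC1 k) -> i != j ->
    #|ball_set n eps (v i) :&: ball_set n eps (v j)|%:R <= D.
  move=> _ _ ij; apply: HD; rewrite ltnNge.
  by have /forallP/(_ j)/implyP/(_ ij) := vC i.
move=> /(_ h1 h2); lra.
Qed.
End covered_bounds.

(** * Brackets for [p_k] and the median, with [d] in place of [2 ^ (- n alpha)] *)

Section parameters.
Context {R : realType} (N a b : nat) (d : R)
  (N2 : (2 <= N)%N) (a0 : (0 < a)%N) (ab : (a <= b)%N) (d0 : 0 < d).
Let n := (a + b)%N.
Let y : R := a%:R / b%:R.
Let s : R := Num.sqrt (8 * a%:R * (1 - a%:R / n%:R)).
Context (HN : (N%:R - 2) * (2 ^+ a * y ^+ (a./2).+1) <= s^-1 - d).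
Let E : R := n%:R ^+ n / (a%:R ^+ a * b%:R ^+ b).

Let aR : 0 < a%:R :> R. Proof. by rewrite ltr0n. Qed.
Let b0 : (0 < b)%N. Proof. exact: leq_trans a0 ab. Qed.
Let bR : 0 < b%:R :> R. Proof. by rewrite ltr0n. Qed.
Let nR : 0 < n%:R :> R. Proof. by rewrite ltr0n addn_gt0 a0. Qed.
Let y0 : 0 < y. Proof. by rewrite divr_gt0. Qed.
Let y1 : y <= 1. Proof. by rewrite ler_pdivrMr // mul1r ler_nat. Qed.
Let EE : E = (1 + y) ^+ n / y ^+ a. Proof. exact: ratio_pow_entropy. Qed.
Let E0 : 0 < E. Proof. by rewrite divr_gt0 ?mulr_gt0 ?exprn_gt0. Qed.

Let V := #|ball_set n a [ffun=> true]|.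

Let VE : V%:R <= E.
Proof. by rewrite EE ler_pdivlMr ?exprn_gt0 // card_ball_weight // y0. Qed.

Let s2 : 2 <= s.
Proof.
have e1 : 1 - a%:R / n%:R = b%:R / n%:R :> R.
  by rewrite /n natrD; field; rewrite -natrD lt0r_neq0.
have e2 : 1 / 2 <= b%:R / n%:R :> R.
  have : a%:R <= b%:R :> R by rewrite ler_nat.
  by rewrite ler_pdivlMr // /n natrD; lra.
have e3 : 1 <= a%:R :> R by rewrite ler1n.
rewrite -(@ler_pXn2r _ 2) ?nnegrE ?sqrtr_ge0 // sqr_sqrtr e1; last first.
  by rewrite !mulr_ge0 ?invr_ge0 // ltW.
nra.
Qed.

(** [HN] bounds [N - 2] times the overlap factor strictly below [1 / s <= 1 / 2], and
    [N - 1 <= 2 (N - 2)] once [N >= 3]. The case [N = 2] is treated apart below. *)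
Let HM : (3 <= N)%N -> N.-1%:R * 2 ^+ a * y ^+ (a./2).+1 < 1.
Proof.
move=> N3; have -> : N.-1%:R = N%:R - 1 :> R.
  by rewrite -[in RHS](prednK (ltnW N2)) -natr1 addrK.
have N3R : 3 <= N%:R :> R by rewrite ler_nat.
have si : s^-1 <= 1 / 2 by rewrite div1r lef_pV2 ?posrE //; have := s2; lra.
have K0 : 0 < 2 ^+ a * y ^+ (a./2).+1 by rewrite mulr_gt0 ?exprn_gt0.
rewrite -mulrA; move: HN d0; nra.
Qed.

Let V3 : V%:R <= 3 ^+ a * (4 / 3) ^+ n :> R.
Proof.
have := @card_ball_weight R n a [ffun=> true] (1 / 3).
rewrite (_ : 1 + 1 / 3 = 4 / 3); last by field.
rewrite div1r exprVn ler_pdivrMr ?exprn_gt0 // mulrC; apply; lra.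
Qed.

Let vol_lt : (N.-1 * V < 2 ^ n)%N.
Proof.
have [N3|] := leqP 3 N.
  rewrite -(ltr_nat R) natrM natrX; apply: le_lt_trans (packing_lt _ _ _ a0 ab (HM N3)).
  by rewrite ler_wpM2l.
rewrite ltnS => N2'; have -> : N = 2%N by apply/eqP; rewrite eqn_leq N2 N2'.
by rewrite mul1n card_ball_lt // -[X in (X < _)%N]addn0 ltn_add2l.
Qed.

Let vol_sqr : N.-1%:R ^+ 2 * V%:R <= 729 * 2 ^+ n :> R.
Proof.
have [N3|] := leqP 3 N.
  apply: le_trans (packing_sqr_le _ _ _ a0 ab (HM N3)).
  by rewrite ler_wpM2l ?exprn_ge0.
rewrite ltnS => N2'; have NE : N = 2%N by apply/eqP; rewrite eqn_leq N2 N2'.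
move: vol_lt; rewrite NE mul1n => /ltnW; rewrite -(ler_nat R) natrX.
have : 0 <= 2 ^+ n :> R by rewrite exprn_ge0.
rewrite expr1n mul1r; lra.
Qed.

Let codes0 : (0 < #|codes n N a|)%N.
Proof.
have [t|v hv] := exists_code n a V N _ vol_lt; first by rewrite (card_ball n a t [ffun=> true]).
apply/card_gt0P; exists [ffun i => v i]; rewrite inE.
apply/forallP => i; apply/forallP => j; apply/implyP => ij; rewrite !ffunE.
exact: hv.
Qed.

Let ballI_le (t u : template n) : (a < ham t u)%N ->
  #|ball_set n a t :&: ball_set n a u|%:R <= 2 * (2 ^+ a * y ^+ (a./2).+1 * E).
Proof.
move=> /card_ballI_far - /(_ a)[u' tu' le].
apply: (@le_trans _ _ #|ball_set n a t :&: ball_set n a u'|%:R); first by rewrite ler_nat.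
have := @card_ballI_weight R n a t u' y; rewrite y0 y1 => /(_ isT tu').
rewrite -ler_pdivlMr ?exprn_gt0 // => /le_trans; apply.
by rewrite EE exprS !mulrA.
Qed.

(** [HN] multiplied by [E]. The subtracted overlap is exactly the [(N - 2) D / 2] of
    [card_covered_ge] with [D] from [ballI_le], so each uncorrected ball volume keeps a surplus
    [E d]. *)
Let vol_ge : E * d + (N%:R - 2) * (2 ^+ a * y ^+ (a./2).+1 * E) <= V%:R.
Proof.
apply: (@le_trans _ _ 'C(n, a)%:R); last by rewrite ler_nat card_ball_ge.
apply: le_trans (bin_ge_entropy_sqrt _ _ a0 b0); rewrite -/n -/s -/E.
by move: (ler_wpM2l (ltW E0) HN); lra.
Qed.

Lemma p_k_itv (k : 'I_N) :
  (N%:R - 1) * (E * d) / 2 ^+ n <= p_k R n a k <= N.-1%:R * V%:R / 2 ^+ n.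
Proof.
apply: p_k_bounds => // v hv; apply/andP; split; last first.
  by rewrite -natrM ler_nat card_covered_le.
apply: le_trans (card_covered_ge n N a v k [ffun=> true] _ (ltnW N2) hv ballI_le).
rewrite ler_wpM2l ?subr_ge0 ?ler1n ?(ltnW N2) //.
by rewrite -/V; have := vol_ge; lra.
Qed.

Lemma m_in_bounds :
  1 / 4 * (2 ^+ n / (E * N%:R ^+ 3)) <= m_in R n N a /\
  m_in R n N a <= 2918 * (2 ^+ n / (E * d * N%:R ^+ 2)).
Proof.
have N0 := ltnW N2.
have NR : 2 <= N%:R :> R by rewrite ler_nat.
have NE : N.-1%:R = N%:R - 1 :> R by rewrite -[in RHS](prednK N0) -natr1 addrK.
have P0 : 0 < 2 ^+ n :> R by rewrite exprn_gt0.
pose lo := (N%:R - 1) * (E * d) / 2 ^+ n; pose hi := N.-1%:R * V%:R / 2 ^+ n : R.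
have Ed0 : 0 < E * d by rewrite mulr_gt0.
have lo0 : 0 < lo by rewrite divr_gt0 // mulr_gt0 //; lra.
have hi1 : hi < 1 by rewrite ltr_pdivrMr // mul1r -natrM -natrX ltr_nat.
have hp (k : 'I_N) : lo <= p_k R n a k <= hi by exact: p_k_itv.
rewrite /m_in /p_w opprB addrCA subrr addr0.
split; last first.
  apply: le_trans (rounds_le N (p_k R n a) lo N0 lo0 _) _.
    by move=> k; have := hp k; lra.
  have Vd : E * d <= V%:R.
    have := vol_ge; have : 0 <= (N%:R - 2) * (2 ^+ a * y ^+ (a./2).+1 * E).
      by rewrite !mulr_ge0 ?exprn_ge0 ?subr_ge0 ?(ltW y0) // ltW.
    lra.
  rewrite /lo; set X := E * d in Ed0 Vd *; set P := 2 ^+ n in P0 *.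
  have HX : (N%:R - 1) ^+ 2 * X <= 729 * P.
    apply: le_trans vol_sqr; rewrite NE ler_wpM2l ?exprn_ge0 //; lra.
  have X0 : 0 < X * N%:R ^+ 2 by rewrite mulr_gt0 // exprn_gt0; lra.
  (* The factor 2 replaces [N - 1] by [N], as [N <= 2 (N - 1)]. *)
  have h1 : (N%:R * ((N%:R - 1) * X / P))^-1 <= 2 * (P / (X * N%:R ^+ 2)).
    rewrite (_ : _^-1 = P / (N%:R * ((N%:R - 1) * X))); last first.
      by rewrite mulrA invf_div.
    have N1 : 0 < N%:R * ((N%:R - 1) * X).
      by apply: mulr_gt0; [lra | apply: mulr_gt0 => //; lra].
    rewrite [leRHS]mulrA ler_pdivrMr // [leRHS]mulrAC ler_pdivlMr //.
    have PX0 : 0 <= P * X by rewrite mulr_ge0 // ltW.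
    have : N%:R ^+ 2 <= 2 * (N%:R * (N%:R - 1)) :> R by nra.
    by move/(ler_wpM2l PX0); lra.
  (* The 1 from the ceiling is absorbed through [vol_sqr]: [2916 = 4 * 729], and
     [2918 = 2 + 2916]. *)
  have h2 : 1 <= 2916 * (P / (X * N%:R ^+ 2)).
    rewrite mulrA ler_pdivlMr // mul1r.
    apply: (@le_trans _ _ (4 * ((N%:R - 1) ^+ 2 * X))); last by lra.
    have : N%:R ^+ 2 <= 4 * (N%:R - 1) ^+ 2 :> R by nra.
    by move/(ler_wpM2r (ltW Ed0)); lra.
  lra.
have EN0 : 0 < E * N%:R ^+ 3 by rewrite mulr_gt0 // exprn_gt0; lra.
have VN : N.-1%:R * V%:R <= N%:R * E.
  by rewrite NE; apply: ler_pM => //; lra.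
(* If [hi > 1 / 2], then [2 ^ n <= 2 N E], so the claimed lower bound is at most 1 and [rounds_ge1]
   suffices. *)
have [hi2|hi2] := leP hi (1 / 2).
  apply: le_trans (rounds_ge N (p_k R n a) hi N0 hi2 _); last first.
    by move=> k; have := hp k; lra.
  have hi0 : 0 < hi by have := hp (Ordinal N0); lra.
  have N1 : 0 < N%:R :> R by lra.
  have A : 0 < 4 * N%:R * hi by apply: mulr_gt0 => //; lra.
  rewrite -[leRHS]div1r ler_pdivlMr //.
  rewrite [leLHS](_ : _ = (N%:R * (N.-1%:R * V%:R)) / (E * N%:R ^+ 3)); last first.
    rewrite /hi; move: (_ * V%:R) (N%:R) (2 ^+ n) E N1 P0 E0 => W m P e m0 p0 e0.
    by field; rewrite !lt0r_neq0.
  rewrite ler_pdivrMr // mul1r; apply: (@le_trans _ _ (N%:R * (N%:R * E))).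
    by rewrite ler_wpM2l.
  have : 0 <= E * N%:R ^+ 2 by rewrite mulr_ge0 ?exprn_ge0 // ltW.
  rewrite !exprS expr0; nra.
apply: (@le_trans _ _ 1); last first.
  by apply: rounds_ge1 => // k; have := hp k; lra.
rewrite mulrA ler_pdivrMr // mul1r.
have : 2 ^+ n <= 2 * (N%:R * E).
  by move: hi2; rewrite /hi ltr_pdivlMr //; lra.
have : N%:R * E <= E * N%:R ^+ 3.
  rewrite mulrC ler_wpM2l ?(ltW E0) // !exprS expr0; nra.
lra.
Qed.
End parameters.

(** * From integer powers to the stated exponents *)

Theorem theorem4p11 (R : realType) :
  exists c C : R, 0 < c /\ 0 < C /\
  forall (n N eps : nat) (alpha : R),
    (2 <= n)%N -> (2 <= N)%N -> (1 <= eps)%N ->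
    (eps%:R / n%:R <= 1 / 2 :> R) ->
    alpha < hbin (eps%:R / n%:R) ->
    N%:R <= 2 + 2 `^ (- eps%:R) *
              ((1 - eps%:R / n%:R) / (eps%:R / n%:R)) `^ ((Num.ceil ((eps%:R + 1) / 2 : R))%:~R)
              * (1 / Num.sqrt (8 * eps%:R * (1 - eps%:R / n%:R)) - 2 `^ (- (n%:R * alpha))) ->
    c * 2 `^ (n%:R * (1 - hbin (eps%:R / n%:R)) - 3 * log2 N%:R) <= m_in R n N eps /\
    m_in R n N eps <= C * 2 `^ (n%:R * (1 - hbin (eps%:R / n%:R) + alpha) - 2 * log2 N%:R).
Proof.
exists (1 / 4), 2918; split; first by lra.
split; first by lra.
move=> n N a alpha n2 N2 a0 hx _ hN.
have {hx n2} [b ab nE] : exists2 b, (a <= b)%N & n = (a + b)%N.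
  have nR : 0 < n%:R :> R by rewrite ltr0n ltnW.
  have : (2 * a <= n)%N.
    by move: hx; rewrite ler_pdivrMr // -(ler_nat R) natrM; lra.
  by move=> an; exists (n - a)%N; lia.
subst n.
have b0 : (0 < b)%N by exact: leq_trans ab.
have aR : 0 < a%:R :> R by rewrite ltr0n.
have bR : 0 < b%:R :> R by rewrite ltr0n.
have NR : 0 < N%:R :> R by rewrite ltr0n ltnW.
have d0 : 0 < 2 `^ (- ((a + b)%:R * alpha)) :> R by rewrite powR_gt0.
(* The assumption on [N] cleared of its prefactors: the ceiling is [a./2 + 1] by [ceil_half], and
   [(1 - a / n) / (a / n)] is [b / a]. *)
have HN : (N%:R - 2) * (2 ^+ a * (a%:R / b%:R) ^+ (a./2).+1) <=
  (Num.sqrt (8 * a%:R * (1 - a%:R / (a + b)%:R)))^-1 - 2 `^ (- ((a + b)%:R * alpha)).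
  move: hN; rewrite ceil_half -pmulrn powR_mulrn; last first.
    rewrite divr_ge0 ?divr_ge0 // subr_ge0 ler_pdivrMr ?mul1r ?ler_nat ?leq_addr //.
    by rewrite ltr0n addn_gt0 a0.
  rewrite [2 `^ (- a%:R)]powRN powR_mulrn // div1r.
  rewrite [(1 - _) / _](_ : _ = (a%:R / b%:R)^-1); last first.
    by rewrite natrD; field; rewrite -natrD !lt0r_neq0 // ltr0n addn_gt0 a0.
  rewrite exprVn -invfM -lerBlDl [X in _ <= X -> _]mulrC ler_pdivlMr //.
  by rewrite mulr_gt0 ?exprn_gt0 ?divr_gt0.
have [lower upper] := m_in_bounds N a b _ N2 a0 ab d0 HN.
have two0 (r s : R) : (r == s) ==> (2 != 0 :> R) by apply/implyP => _; exact: lt0r_neq0.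
have pn : 2 `^ (a + b)%:R = 2 ^+ (a + b) :> R by rewrite powR_mulrn.
rewrite -powR2_entropy // in lower upper.
split.
  apply: le_trans lower; rewrite le_eqVlt; apply/orP; left; apply/eqP.
  rewrite mulrBr mulr1 !powRB // pn powR2_log2 //; congr (_ * _).
  by rewrite [in RHS]invfM mulrA.
apply: le_trans upper _; rewrite le_eqVlt; apply/orP; left; apply/eqP.
set h := hbin _.
have -> : (a + b)%:R * (1 - h + alpha) - 2 * log2 N%:R =
    (a + b)%:R - (a + b)%:R * h - - ((a + b)%:R * alpha) - 2 * log2 N%:R by ring.
rewrite !powRB // pn powR2_log2 //; congr (_ * _).
by rewrite [in LHS]invfM [in LHS]invfM !mulrA.
Qed.
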